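(* Let $f\in(0,1)$ be a target frequency, $\epsilon>0$, $K,P\in\mathbb{Z}_{\ge1}$, and $\eta_g,\eta_s\in(0,1)$. Let $c$ be a candidate pattern whose true frequency $f_c\in[0,1]$ is the fraction of data owners whose local data contain $c$. Suppose $c$ has been responded to in $m_c\ge 1$ rounds, in each of which $P$ data owners respond, so $n_c=Pm_c$, and its accumulated response is $$r_c=\sum_{k=1}^{n_c} B_k+\sum_{\ell=1}^{m_c} G_\ell,$$ where $B_1,\dots,B_{n_c}$ are i.i.d. Bernoulli$(f_c)$ random variables (indicators that the sampled responding data owners contain $c$), $G_1,\dots,G_{m_c}$ are i.i.d. two-sided geometric random variables with parameter $\alpha=e^{-\epsilon/K}$, and the $B_k$ are independent of the $G_\ell$. Then $c$ is not a frequent pattern (i.e. $f_c< f$, or at least $f_c\le f$) with confidence $(1-\eta_g)(1-\eta_s)$ when $$\frac{r_c}{n_c}+\sqrt{\frac{2e^{-\epsilon/K}}{2(1-e^{-\epsilon/K})^2P^2m_c\eta_g}}+\sqrt{\frac{\ln\eta_s}{-2n_c}}\ \le\ f;$$ that is, with probability at least $(1-\eta_g)(1-\eta_s)$ one has $f_c\le \frac{r_c}{n_c}+\sqrt{\frac{2e^{-\epsilon/K}}{2(1-e^{-\epsilon/K})^2P^2m_c\eta_g}}+\sqrt{\frac{\ln\eta_s}{-2n_c}}$, so that whenever the left-hand side of the displayed inequality is at most $f$, $f_c\le f$.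
   Context: A two-sided geometric random variable $G(\alpha)$, $\alpha\in(0,1)$, has $\mathbb{P}(G(\alpha)=x)=\frac{1-\alpha}{1+\alpha}\alpha^{|x|}$ for $x\in\mathbb{Z}$; it arises as the aggregate of the distributed Pólya noises added by the $P$ responders of a candidate in one round. A pattern is frequent if its frequency among the data owners is at least the target frequency $f$. *)

(* Defs.v *)
From HB Require Import structures.
From mathcomp Require Import all_boot all_order all_algebra.
From mathcomp Require Import all_classical all_reals all_analysis.
Set Implicit Arguments. Unset Strict Implicit. Unset Printing Implicit Defensive.
Import Order.TTheory GRing.Theory Num.Theory.
Local Open Scope classical_set_scope.
Local Open Scope ring_scope.

Definition mutually_independent d (T : measurableType d) (R : realType)
  (Pr : probability T R) (I : finType) (X : I -> {RV Pr >-> R}) : Prop :=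
  forall A : I -> set R, (forall i, measurable (A i)) ->
    Pr (\bigcap_(i in [set: I]) (X i @^-1` A i)) =
    (\prod_(i : I) Pr (X i @^-1` A i))%E.

Definition is_bernoulli d (T : measurableType d) (R : realType)
  (Pr : probability T R) (p : R) (X : {RV Pr >-> R}) : Prop :=
  Pr (X @^-1` [set 1]) = p%:E /\ Pr (X @^-1` [set 0]) = (1 - p)%:E.

Definition is_two_sided_geometric d (T : measurableType d) (R : realType)
  (Pr : probability T R) (a : R) (X : {RV Pr >-> R}) : Prop :=
  forall x : int, Pr (X @^-1` [set x%:~R]) = ((1 - a) / (1 + a) * a ^+ absz x)%:E.

(* Main.v *)
(** The accumulated response splits into a sampling part [\sum_k B k] and a noise
    part [\sum_l G l], which are independent, so the confidences multiply.  The
    sampling part is controlled by Hoeffding's lower tail bound.  The noise part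
    is controlled by Chebyshev's inequality, with variance [2a / (1 - a)^2] per
    round; since the noise is symmetric the one-sided tail is half of the
    two-sided one, which accounts for the factor 2 in the denominator of the
    noise radius.  Truncating each [G l] to [[-N, N]] turns all of this into
    finite sums over the joint atoms; the lost mass vanishes as [N] grows. *)

Require Import Defs.
From HB Require Import structures.
From mathcomp Require Import all_boot all_order all_algebra.
From mathcomp Require Import all_classical all_reals all_analysis.
From mathcomp Require Import measurable_realfun.
From mathcomp Require Import ring lra zify.
Import Order.TTheory GRing.Theory Num.Theory.
Import numFieldNormedType.Exports.
Local Open Scope classical_set_scope.
Local Open Scope ring_scope.

(** * Mass and second moment of the truncated two-sided geometric law *)

(** The index [j] encodes the integer [j - N] of [[-N, N]]; each nonzero absolute value occurs
    twice, for the two signs. *)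
Lemma sum_distn_center (R : comNzRingType) (F : nat -> R) (N : nat) :
  \sum_(j < (N.*2).+1) F `|j%:Z - N%:Z|%N =
  F 0%N + 2 * \sum_(i < N) F i.+1.
Proof.
elim: N => [|N IH]; first by rewrite big_ord_recl !big_ord0 mulr0.
rewrite doubleS big_ord_recl [in LHS]big_ord_recr [in RHS]big_ord_recr.
under eq_bigr => i _.
  rewrite (_ : `|_ - _|%N = `|i%:Z - N%:Z|%N); last by rewrite /= /bump; lia.
  over.
rewrite IH mulrDr.
set k0 := (X in F X + _); set k1 := (X in _ + (_ + F X)).
have -> : k0 = N.+1 by rewrite /k0 /=; lia.
have -> : k1 = N.+1 by rewrite /k1 /= /bump; lia.
by rewrite /=; ring.
Qed.

Lemma geometric_mass (R : realFieldType) (a : R) (N : nat) : 0 < a < 1 ->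
  \sum_(j < (N.*2).+1) (1 - a) / (1 + a) * a ^+ `|j%:Z - N%:Z|%N =
  1 - 2 * a ^+ N.+1 / (1 + a).
Proof.
move=> /andP[a0 a1]; have a10 : 1 + a != 0 by rewrite gt_eqF// addr_gt0.
rewrite (sum_distn_center _ (fun i => (1 - a) / (1 + a) * a ^+ i)).
elim: N => [|N IH]; first by rewrite big_ord0; field.
by rewrite big_ord_recr/= mulrDr addrA IH [a ^+ N.+2]exprS; field.
Qed.

(** The right-hand side is the variance of the untruncated law, from which truncation only removes a
    nonnegative tail. *)
Lemma geometric_second_moment (R : realFieldType) (a : R) (N : nat) : 0 < a < 1 ->
  \sum_(j < (N.*2).+1) (1 - a) / (1 + a) * a ^+ `|j%:Z - N%:Z|%N *
     (j%:R - N%:R) ^+ 2 <= 2 * a / (1 - a) ^+ 2.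
Proof.
move=> /andP[a0 a1]; have a10 : 1 + a != 0 by rewrite gt_eqF// addr_gt0.
have a11 : 1 - a != 0 by rewrite subr_eq0 gt_eqF.
rewrite (eq_bigr (fun j : 'I_(N.*2).+1 => (1 - a) / (1 + a) *
  a ^+ `|j%:Z - N%:Z|%N * `|j%:Z - N%:Z|%:R ^+ 2)); last first.
  move=> j _; congr *%R.
  by rewrite natr_absz intr_norm real_normK ?num_real// intrB.
rewrite (sum_distn_center _ (fun i => (1 - a) / (1 + a) * a ^+ i * i%:R ^+ 2)).
(* [r n] is twice the tail [\sum_(i > n) (1 - a) / (1 + a) * a ^+ i * i ^+ 2] in
   closed form. *)
pose r n : R := 2 * (a ^+ n.+1 * (1 - a) / (1 + a)) *
  (n.+1%:R ^+ 2 / (1 - a) + 2 * n.+1%:R * a / (1 - a) ^+ 2 + a * (1 + a) / (1 - a) ^+ 3).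
have r0 : 0 <= r N.
  have b0 : 0 <= 1 - a by rewrite subr_ge0 ltW.
  have c0 : 0 <= 1 + a by rewrite addr_ge0// ltW.
  have a_ge0 := ltW a0.
  rewrite /r; repeat first [exact: ler0n | exact: b0 | exact: c0 | exact: a_ge0
    | rewrite invr_ge0 | apply: exprn_ge0 | apply: mulr_ge0 | apply: addr_ge0].
suff rN : 2 * a / (1 - a) ^+ 2 = (1 - a) / (1 + a) * a ^+ 0 * 0%:R ^+ 2 +
  2 * (\sum_(i < N) (1 - a) / (1 + a) * a ^+ i.+1 * i.+1%:R ^+ 2) + r N.
  by rewrite [leRHS]rN lerDl.
elim: N {r0} => [|N IH]; first by rewrite /r big_ord0; field; rewrite ?a10 ?a11.
rewrite IH /r big_ord_recr/= -[N.+2%:R]natr1 [a ^+ N.+2]exprS.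
by field; rewrite ?a10 ?a11.
Qed.

(** * Second moment and one-sided Chebyshev inequality for finite product weights *)

Lemma sum_prod_ffun (R : comNzRingType) (I J : finType) (F : I -> J -> R) :
  \sum_(g : {ffun I -> J}) \prod_i F i (g i) = \prod_i \sum_j F i j.
Proof. by rewrite -bigA_distr_bigA. Qed.

(** After expanding the square, the cross terms vanish because [v] is centered, and each diagonal
    term is at most [V]. Truncation leaves a mass below 1, hence the assumption [<= 1] on the
    weights. *)
Lemma sum_prod_sqr (R : realFieldType) (I J : finType) (w v : J -> R) (V : R) :
  (forall j, 0 <= w j) -> \sum_j w j <= 1 -> \sum_j w j * v j = 0 ->
  \sum_j w j * v j ^+ 2 <= V ->
  \sum_(g : {ffun I -> J}) (\prod_i w (g i)) * (\sum_i v (g i)) ^+ 2 <= #|I|%:R * V.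
Proof.
move=> w0 w1 wv wV.
(* Each [v (g k) * v (g l)] is absorbed into the product over [i], so that the sum
   over [g] factors. *)
rewrite (eq_bigr (fun g : {ffun I -> J} => \sum_k \sum_l
   \prod_i (w (g i) * ((if i == k then v (g i) else 1) *
     (if i == l then v (g i) else 1))))); last first.
  move=> g _; rewrite expr2 mulr_suml mulr_sumr; apply: eq_bigr => k _.
  rewrite mulrA mulr_sumr; apply: eq_bigr => l _.
  rewrite !big_split/= -!big_mkcond/= !big_pred1_eq; ring.
rewrite exchange_big/=.
have -> : #|I|%:R * V = \sum_(k : I) V by rewrite sumr_const mulr_natl.
apply: ler_sum => k _.
rewrite exchange_big/= (bigD1 k)//= [X in _ + X]big1 ?addr0.
  rewrite (sum_prod_ffun _ _ _ (fun i j => w j * ((if i == k then v j else 1) *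
     (if i == k then v j else 1)))) (bigD1 k)//= eqxx.
  under [X in X * _]eq_bigr do rewrite -expr2.
  rewrite -[V]mulr1 ler_pM//.
  - by apply: sumr_ge0 => j _; rewrite mulr_ge0// sqr_ge0.
  - rewrite prodr_ge0// => i /negbTE->; apply: sumr_ge0 => j _; rewrite mulr1 mulr1 w0//.
  - apply: (@le_trans _ _ (\prod_(i : I | i != k) 1)); last by rewrite big1_eq.
    apply: ler_prod => i /negbTE->; under eq_bigr do rewrite !mulr1.
    by rewrite w1 sumr_ge0.
move=> l lk.
rewrite (sum_prod_ffun _ _ _ (fun i j => w j * ((if i == k then v j else 1) *
     (if i == l then v j else 1)))) (bigD1 k)//= eqxx eq_sym (negbTE lk).
by under eq_bigr do rewrite mulr1; rewrite wv mul0r.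
Qed.

(* Flipping the sign of all coordinates shows that [S < - c] and [c < S] have the
   same mass, which gains a factor 2 over the two-sided inequality. *)
Lemma one_sided_chebyshev (R : realFieldType) (I J : finType) (w v : J -> R)
    (s : J -> J) (V c : R) :
  involutive s -> (forall j, w (s j) = w j) -> (forall j, v (s j) = - v j) ->
  (forall j, 0 <= w j) -> \sum_j w j <= 1 ->
  \sum_j w j * v j ^+ 2 <= V -> 0 < c ->
  \sum_(g : {ffun I -> J} | \sum_i v (g i) < - c) \prod_i w (g i) <=
  #|I|%:R * V / (2 * c ^+ 2).
Proof.
move=> ss ws vs w0 w1 wV c0.
have wv : \sum_j w j * v j = 0.
  suff : \sum_j w j * v j = - \sum_j w j * v j by lra.
  rewrite {1}(reindex_inj (inv_inj ss))/= -sumrN.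
  by apply: eq_bigr => j _; rewrite ws vs mulrN.
have wg0 (g : {ffun I -> J}) : 0 <= \prod_i w (g i) by rewrite prodr_ge0.
pose S (g : {ffun I -> J}) := \sum_i v (g i).
pose t (g : {ffun I -> J}) : {ffun I -> J} := [ffun i => s (g i)].
have tt : involutive t by move=> g; apply/ffunP => i; rewrite !ffunE.
have st : \sum_(g | S g < - c) \prod_i w (g i) = \sum_(g | c < S g) \prod_i w (g i).
  rewrite (reindex_inj (inv_inj tt))/=; apply: eq_big => g.
    rewrite /S; under eq_bigr do rewrite ffunE vs.
    by rewrite sumrN ltrN2.
  by move=> _; apply: eq_bigr => i _; rewrite ffunE ws.
have c2 : 0 < c ^+ 2 by rewrite exprn_gt0.
rewrite -/S ler_pdivlMr ?mulr_gt0//.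
apply: le_trans (sum_prod_sqr _ I J w v V w0 w1 wv wV).
(* Twice the lower tail is the sum of both tails. They are disjoint since [0 < c], and on each of
   them [S g ^+ 2 / c ^+ 2] is at least 1. *)
rewrite mulrA -/(S _) mulr_natr mulr2n {2}st -ler_pdivlMr//.
rewrite (big_mkcond (fun g => _ < - c)) (big_mkcond (fun g => c < S g)) -big_split/= mulr_suml.
apply: ler_sum => g _; rewrite -mulrA -/(S g).
case: ifPn => h; case: ifPn => k.
- by exfalso; move: h k; lra.
- by rewrite addr0 ler_peMr// ler_pdivlMr// mul1r; nra.
- by rewrite add0r ler_peMr// ler_pdivlMr// mul1r; nra.
- by rewrite addr0 mulr_ge0// divr_ge0// ?sqr_ge0// ltW.
Qed.

Lemma truncated_geometric_upper_mass (R : realFieldType) (I : finType) (a c : R)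
    (N : nat) : 0 < a < 1 -> 0 < c ->
  (1 - 2 * a ^+ N.+1 / (1 + a)) ^+ #|I| -
    #|I|%:R * (2 * a / (1 - a) ^+ 2) / (2 * c ^+ 2) <=
  \sum_(g : {ffun I -> 'I_(N.*2).+1} | - c <= \sum_i ((g i)%:R - N%:R))
    \prod_i ((1 - a) / (1 + a) * a ^+ `|(g i)%:Z - N%:Z|%N).
Proof.
move=> a01 c0; have /andP[a0 a1] := a01; rewrite lerBlDr.
pose w (j : 'I_(N.*2).+1) := (1 - a) / (1 + a) * a ^+ `|j%:Z - N%:Z|%N.
pose v (j : 'I_(N.*2).+1) : R := j%:R - N%:R.
have <- : \sum_(g : {ffun I -> 'I_(N.*2).+1}) \prod_i w (g i) =
    (1 - 2 * a ^+ N.+1 / (1 + a)) ^+ #|I|.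
  by rewrite (sum_prod_ffun _ _ _ (fun i j => w j)) prodr_const geometric_mass.
rewrite (bigID (fun g : {ffun I -> 'I_(N.*2).+1} => - c <= \sum_i v (g i)))/=.
rewrite lerD2l; under eq_bigl do rewrite -ltNge.
(* [rev_ord] maps [j] to [2N - j], which is the sign change of [j - N]. *)
apply: (one_sided_chebyshev _ _ _ w v (@rev_ord _)) => //.
- exact: rev_ordK.
- move=> j; rewrite /w /=; congr (_ * a ^+ _); have := ltn_ord j; lia.
- move=> j; have jN : (j <= N.*2)%N by rewrite -ltnS.
  rewrite /v /= subSS; move: (nat_of_ord j) jN => k kN.
  by rewrite natrB// -muln2 natrM; ring.
- move=> j; have b0 : 0 <= 1 - a by rewrite subr_ge0 ltW.
  by rewrite mulr_ge0 ?exprn_ge0 ?divr_ge0// ?addr_ge0// ltW.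
- rewrite geometric_mass// gerBl divr_ge0 ?mulr_ge0 ?exprn_ge0 ?addr_ge0//; exact: ltW.
- exact: geometric_second_moment.
Qed.

(** * Hoeffding's lower tail bound for Bernoulli sums *)

Lemma ge0_derive_le (R : realType) (f df : R -> R) :
  (forall x : R, is_derive x 1 f (df x)) -> (forall x, 0 <= x -> 0 <= df x) ->
  forall x, 0 <= x -> f 0 <= f x.
Proof.
move=> fdf df0 x x0.
have cf : {within `[0, x], continuous f}.
  apply/continuous_subspaceT => y.
  by apply/differentiable_continuous/derivable1_diffP; case: (fdf y).
have [c] := MVT_segment x0 (fun y _ => fdf y) cf.
rewrite in_itv/= subr0 => /andP[c0 _] h.
by rewrite -subr_ge0 h mulr_ge0// df0.
Qed.

(** Hoeffding's lemma for a Bernoulli variable. The difference [h] of the logarithms of the two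
    sides vanishes at 0, as does its derivative [g], and [g] is nondecreasing. *)
Lemma bernoulli_mgf_le (R : realType) (p x : R) : 0 <= p <= 1 -> 0 <= x ->
  1 - p + p * expR (- x) <= expR (x ^+ 2 / 8 - x * p).
Proof.
move=> /andP[p0 p1] x0.
(* [u y] is [expR y] times the left-hand side at [y]. *)
pose u (y : R) := p + (1 - p) * expR y.
have u0 y : 0 < u y.
  have := expR_gt0 y; rewrite /u; move: (expR y) => e e0.
  have [->|pn0] := eqVneq p 0; first by rewrite add0r subr0 mul1r.
  by rewrite ltr_pwDl ?lt_def ?pn0//= mulr_ge0 ?subr_ge0// ltW.
have du (y : R) : is_derive y 1 u ((1 - p) * expR y).
  rewrite (_ : u = cst p + (1 - p) *: expR).
    have dD := is_deriveD (is_derive_cst p y 1)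
      (is_deriveZ (1 - p) (is_derive_expR y)).
    by apply: (is_derive_eq dD); rewrite add0r.
  by apply/funext.
pose g (y : R) := p / u y + y / 4 - p.
have g0 y : 0 <= y -> 0 <= g y.
  move=> y0.
  have -> : 0 = g 0 by rewrite /g /u expR0 mulr1 subrKC; field.
  pose dg (z : R) := 4^-1 - p * ((1 - p) * expR z) / u z ^+ 2.
  apply: (@ge0_derive_le R g dg) y0; first last.
    (* The derivative of [g] is nonnegative by the AM-GM inequality for the two summands of
       [u z]. *)
    move=> z _; rewrite subr_ge0 ler_pdivrMr ?exprn_gt0//.
    by have := sqr_ge0 (p - (1 - p) * expR z); rewrite /u; lra.
  move=> z; have uz : u z != 0 by rewrite gt_eqF.
  have dV := is_deriveV uz (du z).
  have dgz := is_deriveB (is_deriveD (is_deriveZ p dV)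
    (is_deriveZ 4^-1 (is_derive_id z 1))) (is_derive_cst p z 1).
  rewrite (_ : g = p *: (fun y => (u y)^-1) + 4^-1 *: id - cst p); last first.
    by apply/funext => t; rewrite /g mulrC [t / _]mulrC mulrC.
  apply: (is_derive_eq dgz).
  by rewrite /= subr0 /dg /GRing.scale/=; field.
pose h (y : R) := y ^+ 2 / 8 + (1 - p) * y - ln (u y).
have h0 : 0 <= h x.
  have -> : 0 = h 0 by rewrite /h /u expR0 mulr1 subrKC ln1 expr0n /=; ring.
  apply: (@ge0_derive_le R h g) x0; last exact: g0.
  move=> z; have dl := is_derive1_comp (is_derive1_ln (u0 z)) (du z).
  have dh := is_deriveB (is_deriveD (is_deriveZ 8^-1
    (is_deriveX 2 (is_derive_id z 1)))
    (is_deriveZ (1 - p) (is_derive_id z 1))) dl.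
  rewrite (_ : h = 8^-1 *: (id ^+ 2) + (1 - p) *: id - (@ln R \o u)); last first.
    by apply/funext => t; rewrite /h mulrC.
  apply: (is_derive_eq dh); rewrite /GRing.scale/= /g /u.
  by field; rewrite gt_eqF// u0.
have -> : 1 - p + p * expR (- x) = expR (ln (u x) - x).
  by rewrite expRD lnK ?posrE// /u expRN; field; rewrite gt_eqF ?expR_gt0.
by rewrite ler_expR; move: h0; rewrite /h; lra.
Qed.

(** Chernoff's method: the indicator of the tail is at most [expR (l * (n * (p - t) - \sum_i b i))],
    whose weighted sum factors over the coordinates. *)
Lemma bernoulli_lower_tail (R : realType) (I : finType) (p t : R) :
  0 <= p <= 1 -> 0 <= t ->
  \sum_(b : {ffun I -> bool} | \sum_i (b i)%:R < #|I|%:R * (p - t))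
    \prod_i (if b i then p else 1 - p) <= expR (- 2 * #|I|%:R * t ^+ 2).
Proof.
move=> p01 t0; have /andP[p0 p1] := p01.
set n : R := #|I|%:R.
(* [4 * t] minimizes [l ^+ 2 / 8 - l * t], the exponent in Chernoff's bound. *)
pose l := 4 * t.
have w0 (b : {ffun I -> bool}) : 0 <= \prod_i (if b i then p else 1 - p).
  by apply: prodr_ge0 => i _; case: ifP => _ //; rewrite subr_ge0.
apply: (@le_trans _ _ (\sum_(b : {ffun I -> bool}) expR (l * (n * (p - t))) *
    \prod_i ((if b i then p else 1 - p) * expR (- l * (b i)%:R)))).
  rewrite [leLHS]big_mkcond/=; apply: ler_sum => b _.
  rewrite big_split/= mulrCA -expR_sum -mulr_sumr -expRD.
  case: ifPn => [bn|_]; last by rewrite mulr_ge0// expR_ge0.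
  rewrite ler_peMr// mulNr -mulrBr.
  suff h : 0 <= l * (n * (p - t) - \sum_i (b i)%:R).
    by rewrite (le_trans _ (expR_ge1Dx _))// lerDl.
  by rewrite mulr_ge0 ?mulr_ge0// subr_ge0 ltW.
rewrite -mulr_sumr (sum_prod_ffun _ _ _ (fun i b =>
  (if b then p else 1 - p) * expR (- l * b%:R))) prodr_const.
rewrite big_bool/= mulr1 mulr0 expR0 mulr1 [p * _ + _]addrC.
have l0 : 0 <= l by rewrite mulr_ge0.
have h := @bernoulli_mgf_le R p l p01 l0.
apply: (@le_trans _ _ (expR (l * (n * (p - t))) * expR (l ^+ 2 / 8 - l * p) ^+ #|I|)).
  rewrite ler_wpM2l ?expR_ge0// lerXn2r ?nnegrE ?expR_ge0//.
  by rewrite addr_ge0 ?mulr_ge0 ?expR_ge0// subr_ge0.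
rewrite -expRM_natl -expRD ler_expR -/n /l; lra.
Qed.

Lemma bernoulli_upper_mass (R : realType) (I : finType) (p t : R) :
  0 <= p <= 1 -> 0 <= t ->
  1 - expR (- 2 * #|I|%:R * t ^+ 2) <=
  \sum_(b : {ffun I -> bool} | #|I|%:R * (p - t) <= \sum_i (b i)%:R)
    \prod_i (if b i then p else 1 - p).
Proof.
move=> p01 t0; rewrite lerBlDr.
have w1 : \sum_(b : {ffun I -> bool}) \prod_i (if b i then p else 1 - p) = 1.
  rewrite (sum_prod_ffun _ _ _ (fun i b => if b then p else 1 - p)) big1// => i _.
  by rewrite big_bool/= subrKC.
rewrite -[leLHS]w1 (bigID (fun b : {ffun I -> bool} =>
  #|I|%:R * (p - t) <= \sum_i (b i)%:R))/=.
rewrite lerD2l; under eq_bigl do rewrite -ltNge.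
exact: bernoulli_lower_tail.
Qed.

(** * From probabilities to finite sums over joint atoms, and removal of the truncation *)

(** The atoms are disjoint, have product probability by independence, and those in [Q] lie inside
    [E]. Since only a lower bound is sought, they need not exhaust [E]. *)
Lemma independent_atoms_le (R : realType) (d : measure_display)
    (T : measurableType d) (Pr : probability T R) (I K : finType)
    (X : I -> {RV Pr >-> R}) (x : K -> I -> R) (w : K -> I -> R)
    (E : set T) (Q : {pred K}) :
  mutually_independent X ->
  (forall k k', x k =1 x k' -> k = k') ->
  (forall k i, Pr (X i @^-1` [set x k i]) = (w k i)%:E) ->
  measurable E ->
  (forall k t, Q k -> (forall i, X i t = x k i) -> E t) ->
  ((\sum_(k | Q k) \prod_i w k i)%:E <= Pr E)%E.
Proof.
move=> indX x_inj Xx mE QE.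
pose C k := \bigcap_(i in [set: I]) (X i @^-1` [set x k i]).
have mC k : measurable (C k) by exact: fin_bigcap_measurable.
have PC k : Pr (C k) = (\prod_i w k i)%:E.
  rewrite indX => [|i]; last exact: measurable_set1.
  by rewrite -prodEFin; apply: eq_bigr => i _.
have tC : trivIset [set` Q] C.
  move=> k k' _ _ [t [Ct C't]]; apply: x_inj => i.
  by rewrite -(Ct i)// -(C't i).
have -> : (\sum_(k | Q k) \prod_i w k i)%:E = Pr (\bigcup_(k in [set` Q]) C k).
  rewrite measure_fin_bigcup//.
  rewrite (_ : [set` Q] = [set` enum Q]); last first.
    by apply/seteqP; split => k /=; rewrite mem_enum.
  rewrite -fsbig_seq ?enum_uniq// big_enum -sumEFin.
  by apply: eq_bigr => k _; rewrite -PC.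
apply: le_measure; rewrite ?inE//.
  exact: fin_bigcup_measurable.
by move=> t [k Qk Ct]; apply: (QE k) => // i; apply: Ct.
Qed.

(** An atom is a Bernoulli outcome paired with a noise vector in [[-N, N]]. Over the rectangle [Qb]
    times [Qg] the joint weight factors into the sampling mass and the noise mass. *)
Lemma confidence_of_truncation (R : realType) (d : measure_display)
    (T : measurableType d) (Pr : probability T R) (n m N : nat) (p a t c : R)
    (B : 'I_n -> {RV Pr >-> R}) (G : 'I_m -> {RV Pr >-> R}) (E : set T) :
  0 <= p <= 1 -> 0 < a < 1 -> 0 <= t -> 0 < c ->
  (forall k, is_bernoulli p (B k)) ->
  (forall l, is_two_sided_geometric a (G l)) ->
  mutually_independent
    (fun i : 'I_n + 'I_m => match i with inl k => B k | inr l => G l end) ->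
  measurable E ->
  (forall x, n%:R * (p - t) <= \sum_k B k x -> - c <= \sum_l G l x -> E x) ->
  let q := expR (- 2 * n%:R * t ^+ 2) in q <= 1 ->
  (((1 - q) *
    ((1 - 2 * a ^+ N.+1 / (1 + a)) ^+ m -
      m%:R * (2 * a / (1 - a) ^+ 2) / (2 * c ^+ 2)))%:E <= Pr E)%E.
Proof.
move=> p01 a01 t0 c0 BB GG indBG mE BGE q q1.
have /andP[a0 a1] := a01.
pose J := 'I_(N.*2).+1.
pose x (k : {ffun 'I_n -> bool} * {ffun 'I_m -> J}) (i : 'I_n + 'I_m) : R :=
  match i with inl i => (k.1 i)%:R | inr l => (k.2 l)%:R - N%:R end.
pose w (k : {ffun 'I_n -> bool} * {ffun 'I_m -> J}) (i : 'I_n + 'I_m) : R :=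
  match i with inl i => if k.1 i then p else 1 - p
  | inr l => (1 - a) / (1 + a) * a ^+ `|(k.2 l)%:Z - N%:Z|%N end.
pose Qb (b : {ffun 'I_n -> bool}) := n%:R * (p - t) <= \sum_i (b i)%:R.
pose Qg (g : {ffun 'I_m -> J}) := - c <= \sum_i ((g i)%:R - N%:R).
apply: le_trans (independent_atoms_le R d T Pr _ _ _ x w E
  (fun k => Qb k.1 && Qg k.2) indBG _ _ mE _).
- rewrite lee_fin.
  under eq_bigr do rewrite big_sumType/=.
  rewrite -(pair_big Qb Qg (fun b g => (\prod_i (if b i then p else 1 - p)) *
    \prod_l ((1 - a) / (1 + a) * a ^+ `|(g l)%:Z - N%:Z|%N)))/=.
  under eq_bigr do rewrite -mulr_sumr.
  rewrite -mulr_suml.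
  have hB := bernoulli_upper_mass R 'I_n p t p01 t0.
  have hG := truncated_geometric_upper_mass R 'I_m a c N a01 c0.
  rewrite !card_ord in hB hG.
  (* The lower bound on the noise mass may be negative, so the two factors are replaced one at a
     time, the other one being nonnegative. *)
  apply: (@le_trans _ _ ((1 - q) * \sum_(g | Qg g)
    \prod_l ((1 - a) / (1 + a) * a ^+ `|(g l)%:Z - N%:Z|%N))).
    by rewrite ler_wpM2l ?subr_ge0.
  rewrite ler_wpM2r//; apply: sumr_ge0 => g _; apply: prodr_ge0 => l _.
  by rewrite mulr_ge0 ?exprn_ge0 ?divr_ge0 ?subr_ge0 ?addr_ge0// ltW.
- move=> [b g] [b' g'] xx; congr pair; apply/ffunP => i.
    have := xx (inl i); rewrite /x/= => /eqP.
    by rewrite eqr_nat; case: (b i); case: (b' i).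
  have := xx (inr i); rewrite /x/= => /addIr/eqP.
  by rewrite eqr_nat => /eqP/val_inj.
- move=> k [i|l] /=.
    by have [B1 B0] := BB i; case: (k.1 i).
  by rewrite -(GG l) intrB.
- move=> k y /andP[kb kg] Xk; apply: BGE.
    by rewrite (eq_bigr (fun i => (k.1 i)%:R))// => i _; rewrite (Xk (inl i)).
  by rewrite (eq_bigr (fun i => (k.2 i)%:R - N%:R))// => i _; rewrite (Xk (inr i)).
Qed.

(** The event [E] does not depend on [N], so the truncated bound passes to the limit, where
    [a ^+ N.+1] tends to 0. *)
Lemma confidence (R : realType) (d : measure_display)
    (T : measurableType d) (Pr : probability T R) (n m : nat) (p a t c : R)
    (B : 'I_n -> {RV Pr >-> R}) (G : 'I_m -> {RV Pr >-> R}) (E : set T) :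
  0 <= p <= 1 -> 0 < a < 1 -> 0 <= t -> 0 < c ->
  (forall k, is_bernoulli p (B k)) ->
  (forall l, is_two_sided_geometric a (G l)) ->
  mutually_independent
    (fun i : 'I_n + 'I_m => match i with inl k => B k | inr l => G l end) ->
  measurable E ->
  (forall x, n%:R * (p - t) <= \sum_k B k x -> - c <= \sum_l G l x -> E x) ->
  (((1 - expR (- 2 * n%:R * t ^+ 2)) *
    (1 - m%:R * (2 * a / (1 - a) ^+ 2) / (2 * c ^+ 2)))%:E <= Pr E)%E.
Proof.
move=> p01 a01 t0 c0 BB GG indBG mE BGE; set q := expR _; set V := _ / (2 * _).
have /andP[a0 a1] := a01.
have q1 : q <= 1.
  by rewrite expR_le1 !mulNr oppr_le0 !mulr_ge0 ?sqr_ge0.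
have PE : Pr E \is a fin_num by exact: fin_num_measure.
pose u N := (1 - q) * ((1 - 2 * a ^+ N.+1 / (1 + a)) ^+ m - V).
have uP N : u N <= fine (Pr E).
  rewrite -lee_fin fineK//.
  exact: (confidence_of_truncation R d T Pr n m N p a t c B G E).
rewrite -[Pr E]fineK// lee_fin.
have mass1 : (fun N : nat => 1 - 2 * a ^+ N.+1 / (1 + a) : R) @ \oo --> (1 : R).
  rewrite -[X in _ --> X]subr0; apply: cvgB; first exact: cvg_cst.
  rewrite -[X in _ --> X](mulr0 (2 * a / (1 + a))).
  rewrite (_ : (fun _ => _) = (fun N => 2 * a / (1 + a) * a ^+ N)); last first.
    by apply/funext => N; rewrite exprS; ring.
  apply: cvgM; first exact: cvg_cst.
  by apply: cvg_expr; rewrite ger0_norm// ltW.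
have massX k :
    (fun N : nat => (1 - 2 * a ^+ N.+1 / (1 + a)) ^+ k : R) @ \oo --> (1 : R).
  elim: k => [|k IH]; first exact: cvg_cst.
  rewrite -[X in _ --> X]mulr1.
  under eq_fun do rewrite exprS.
  exact: cvgM.
have ul : u @ \oo --> (1 - q) * (1 - V).
  rewrite /u; apply: cvgM; first exact: cvg_cst.
  by apply: cvgB; [exact: massX|exact: cvg_cst].
apply: (cvgr_to_le ul); exact: nearW.
Qed.

(** * Choice of the radii and the resulting confidence statement *)

Theorem theorem4 (R : realType) (f eps : R) (K P : nat) (eta_g eta_s : R)
  (f_c : R) (m_c : nat)
  (d : measure_display) (T : measurableType d) (Pr : probability T R)
  (B : 'I_(P * m_c) -> {RV Pr >-> R}) (G : 'I_m_c -> {RV Pr >-> R}) :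
  0 < f < 1 -> 0 < eps -> (1 <= K)%N -> (1 <= P)%N ->
  0 < eta_g < 1 -> 0 < eta_s < 1 -> 0 <= f_c <= 1 -> (1 <= m_c)%N ->
  (forall k, is_bernoulli f_c (B k)) ->
  (forall l, is_two_sided_geometric (expR (- eps / K%:R)) (G l)) ->
  mutually_independent
    (fun i : 'I_(P * m_c) + 'I_m_c => match i with inl k => B k | inr l => G l end) ->
  let n_c := (P * m_c)%N in
  let r_c := fun t => \sum_(k < P * m_c) B k t + \sum_(l < m_c) G l t in
  let alpha := expR (- eps / K%:R) in
  let bound := fun t =>
    r_c t / n_c%:R
    + Num.sqrt (2 * alpha / (2 * (1 - alpha) ^+ 2 * P%:R ^+ 2 * m_c%:R * eta_g))
    + Num.sqrt (ln eta_s / (- 2 * n_c%:R)) in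
  (((1 - eta_g) * (1 - eta_s))%:E <= Pr [set t | (f_c <= bound t)%R])%E /\
  (((1 - eta_g) * (1 - eta_s))%:E <= Pr [set t | (bound t <= f)%R -> (f_c <= f)%R])%E.
Proof.
move=> f01 eps0 K1 P1 /andP[g0 g1] /andP[s0 s1] fc01 m1 BB GG indBG n_c r_c alpha bound.
have alpha01 : 0 < alpha < 1.
  rewrite expR_gt0 -expR0 ltr_expR mulNr oppr_lt0 divr_gt0//=.
  by rewrite ltr0n.
have /andP[alpha0 alpha1] := alpha01.
have P0 : 0 < P%:R :> R by rewrite ltr0n.
have m0 : 0 < m_c%:R :> R by rewrite ltr0n.
have n0 : 0 < n_c%:R :> R by rewrite natrM mulr_gt0.
have beta0 : 0 < 1 - alpha by rewrite subr_gt0.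
set tg := Num.sqrt (2 * alpha / _) in bound *.
set ts := Num.sqrt (ln eta_s / _) in bound *.
have tg0 : 0 < tg.
  by rewrite sqrtr_gt0 divr_gt0 ?mulr_gt0 ?exprn_gt0.
have tg2 : tg ^+ 2 = 2 * alpha / (2 * (1 - alpha) ^+ 2 * P%:R ^+ 2 * m_c%:R * eta_g).
  by rewrite sqr_sqrtr// ltW// -sqrtr_gt0.
have lns : ln eta_s < 0 by rewrite ln_lt0// s0 s1.
have ts2 : ts ^+ 2 = ln eta_s / (- 2 * n_c%:R).
  rewrite sqr_sqrtr// mulNr invrN mulrN -mulNr divr_ge0 ?oppr_ge0 ?mulr_ge0//; exact: ltW.
have mr : measurable_fun [set: T] r_c.
  apply: measurable_funD; apply: measurable_sum => i; exact: measurable_funP.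
have mbound : measurable_fun [set: T] bound.
  do 2 apply: measurable_funD => //.
  by apply: measurable_funM.
have E1 : measurable [set t | f_c <= bound t].
  rewrite -(setTI [set t | _ <= _]).
  exact: (measurable_fun_le measurableT).
have E2 : measurable [set t | bound t <= f -> f_c <= f].
  have [h|h] := boolP (f_c <= f).
    by rewrite (_ : [set _ | _] = setT)//; apply/seteqP; split.
  rewrite (_ : [set _ | _] = ~` [set t | bound t <= f]).
    apply: measurableC; rewrite -(setTI [set t | _ <= _]).
    exact: (measurable_fun_le measurableT).
  by apply/seteqP; split => t /=; [move=> k /k|move=> k /k].
(* The radii make the Hoeffding failure bound exactly [eta_s] and the Chebyshev failure bound
   exactly [eta_g]. *)
have -> : (1 - eta_g) * (1 - eta_s) = (1 - expR (- 2 * n_c%:R * ts ^+ 2)) *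
    (1 - m_c%:R * (2 * alpha / (1 - alpha) ^+ 2) / (2 * (n_c%:R * tg) ^+ 2)).
  rewrite mulrC ts2; congr ((1 - _) * (1 - _)).
    by rewrite mulrC divfK ?lnK// mulf_neq0// ?gt_eqF// oppr_eq0.
  rewrite exprMn tg2 natrM; field.
  by rewrite !gt_eqF.
have main : (((1 - expR (- 2 * n_c%:R * ts ^+ 2)) *
    (1 - m_c%:R * (2 * alpha / (1 - alpha) ^+ 2) / (2 * (n_c%:R * tg) ^+ 2)))%:E
    <= Pr [set t | (f_c <= bound t)%R])%E.
  (* The noise enters the estimate divided by [n_c], so its threshold is [n_c] times the radius
     [tg]. *)
  apply: (confidence R d T Pr n_c m_c f_c alpha ts (n_c%:R * tg) B G) => //.
  - exact: sqrtr_ge0.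
  - exact: mulr_gt0.
  - move=> x xB xG; rewrite /bound/= /r_c mulrDl.
    have : f_c - ts <= (\sum_k B k x) / n_c%:R by rewrite ler_pdivlMr// mulrC.
    have : - tg <= (\sum_l G l x) / n_c%:R by rewrite ler_pdivlMr// mulNr mulrC.
    by lra.
split; first exact: main.
apply: le_trans main _; apply: le_measure; rewrite ?inE//.
by move=> t /= h h'; apply: le_trans h h'.
Qed.
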